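(* For each $i\in\mathbb{Z}^+$ let $\rho_i\in S_{12+2i}$ be the permutation given by $$(\rho_i(1),\rho_i(2),\rho_i(3),\rho_i(4))=(2,3,5,1),$$ $$(\rho_i(9+2i),\rho_i(10+2i),\rho_i(11+2i),\rho_i(12+2i))=(10+2i,\,11+2i,\,12+2i,\,8+2i),$$ and, for $5\le j\le 8+2i$, $\rho_i(j)=j+2$ if $j$ is odd and $\rho_i(j)=j-2$ if $j$ is even. Then for every $i\in\mathbb{Z}^+$ the catergram $\mathcal{T}_{\rho_i}$ is planar.
   Context: $[n]=\{1,\dots,n\}$ and $S_n$ is the symmetric group on $[n]$. A rooted tree is a tree with a distinguished vertex, the root; it is binary if every vertex has zero or two children. Leaves are the vertices with no children. Caterpillar: for $n\ge 2$, the rooted caterpillar $C_n$ is the rooted binary tree with $n$ leaves whose $n-1$ internal vertices form a path with the root as an endvertex of this path. Equivalently, it has exactly two leaves at distance $n-1$ from the root and, for each $1\le i\le n-2$, exactly one leaf at distance $i$ from the root. Tanglegram: a tanglegram of size $n$ is an ordered triplet $(T_1,T_2,M)$ where $T_1$ (left tree) and $T_2$ (right tree) are rooted binary trees with $n$ leaves each and $M$ is a perfect matching between the two leaf sets. Two tanglegrams are considered the same if there is a graph isomorphism between them (respecting left tree, right tree and matching) that sends the root of the left tree to the root of the left tree and the root of the right tree to the root of the right tree. Catergram: the distance labeling of the leaves of $C_n$ gives label $i$ to the leaf at distance $i$ from the root for $1\le i\le n-2$, and labels the two leaves at distance $n-1$ arbitrarily by $n-1$ and $n$. For $n\ge 2$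 and $\pi\in S_n$, the catergram $\mathcal{T}_\pi$ is the tanglegram $(C_n,C_n,M_\pi)$ in which, with the distance labeling on both caterpillars, the leaf of the left tree labeled $i$ is matched with the leaf of the right tree labeled $j$ if and only if $\pi(i)=j$. Layout and planarity: a plane binary tree is a rooted binary tree in which the children of internal vertices are specified as left and right children; it is drawn on one side of a line, without edge crossings, such that exactly its leaves lie on the line (in the order determined by the left/right choices). A layout $(L,R,M)$ of a tanglegram $(T_1,T_2,M)$ is given by a left plane binary tree $L$ isomorphic to $T_1$ drawn in the halfplane $x\le 0$ with its leaves on the line $x=0$, a right plane binary tree $R$ isomorphic to $T_2$ drawn in the halfplane $x\ge 1$ with its leaves on the line $x=1$, and the perfect matching $M$ between their leaves drawn as straight line segments. A tanglegram is planar if it has a layout without crossing edges. *)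

(* Defs.v *)
From HB Require Import structures.
From mathcomp Require Import all_boot all_order all_algebra all_fingroup.
From mathcomp Require Import reals zify.

Set Implicit Arguments.
Unset Strict Implicit.
Unset Printing Implicit Defensive.

Import Order.TTheory GRing.Theory Num.Theory.

(** * Rooted binary trees *)

(* [ucycle adj c] lists the vertices of a closed walk without repetition, so
   the sizes 0 and 2 (an edge walked back and forth) must be tolerated: a graph
   cycle is one of size at least 3. *)
Record rooted_tree := RootedTree {
  vertex :> finType;
  adj : rel vertex;
  root : vertex;
  adj_sym : symmetric adj;
  adj_irr : irreflexive adj;
  adj_connected : forall x y, connect adj x y;
  adj_acyclic : forall c, ucycle adj c -> size c <= 2
}.

Arguments adj {r} : rename.
Arguments root {r} : rename.

Definition walk (V : finType) (e : rel V) (x y : V) (k : nat) : bool :=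
  [exists p : k.-tuple V, path e x p && (last x p == y)].

Lemma connect_walk (V : finType) (e : rel V) (x y : V) :
  connect e x y -> exists k, walk e x y k.
Proof.
case/connectP => p pp ->; exists (size p); apply/existsP.
by exists (in_tuple p); rewrite pp eqxx.
Qed.

Section Distance.
Variable T : rooted_tree.
Implicit Types v w x y : T.

Definition dist x y : nat := ex_minn (connect_walk (adj_connected x y)).

Definition child v w : bool := adj v w && (dist root w == (dist root v).+1).

Definition children v : {set T} := [set w | child v w].

Definition leaf v : bool := children v == set0.

Definition is_binary : Prop := forall v, #|children v| = 0 \/ #|children v| = 2.

End Distance.

Record rbtree := RBTree {
  rooted_of :> rooted_tree;
  rbtree_binary : is_binary rooted_of
}.

(** * Tanglegrams *)

Record tanglegram (n : nat) := Tanglegram {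
  ltree : rbtree;
  rtree : rbtree;
  tmatch : ltree -> rtree -> bool;
  ltree_size : #|[set x : ltree | leaf x]| = n;
  rtree_size : #|[set y : rtree | leaf y]| = n;
  tmatch_leaf : forall x y, tmatch x y -> leaf x && leaf y;
  tmatch_l : forall x, leaf x -> exists! y, tmatch x y;
  tmatch_r : forall y, leaf y -> exists! x, tmatch x y
}.

Arguments tmatch {n} t x y : rename.

Definition rooted_iso (T T' : rooted_tree) (f : T -> T') : Prop :=
  [/\ bijective f, forall x y, adj (f x) (f y) = adj x y & f root = root].

Definition tangle_iso (n : nat) (T T' : tanglegram n) : Prop :=
  exists (f : ltree T -> ltree T') (g : rtree T -> rtree T'),
    [/\ rooted_iso f, rooted_iso g
      & forall x y, tmatch T' (f x) (g y) = tmatch T x y].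

(** * Layouts and planarity *)

(* A plane binary tree is a rooted binary tree with such a structure; the
   values of [lchild] and [rchild] at a leaf are irrelevant. *)
Record plane (T : rbtree) := Plane {
  lchild : T -> T;
  rchild : T -> T;
  plane_children : forall v, ~~ leaf v -> children v = [set lchild v; rchild v]
}.

Definition left_of (T : rbtree) (P : plane T) (x y : T) : Prop :=
  exists v, [/\ ~~ leaf v, connect (@child T) (lchild P v) x
                         & connect (@child T) (rchild P v) y].

(* The drawing of a plane tree inside its own halfplane never meets the other
   halfplane or the strip between the two lines, so it is represented by what
   it prescribes: the leaf [x] lies at [(0, lpos x)] (left tree) or
   [(1, rpos x)] (right tree), and the heights respect the left-to-right order.
   On both sides left-to-right is read as upwards; the opposite choice on
   either side amounts to exchanging [lchild] and [rchild] there. *)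
Record layout (R : realType) (n : nat) (T : tanglegram n) := Layout {
  drawn : tanglegram n;
  drawn_iso : tangle_iso drawn T;
  lplane : plane (ltree drawn);
  rplane : plane (rtree drawn);
  lpos : ltree drawn -> R;
  rpos : rtree drawn -> R;
  lpos_mono : forall x x', leaf x -> leaf x' ->
    left_of lplane x x' -> (lpos x < lpos x')%R;
  rpos_mono : forall y y', leaf y -> leaf y' ->
    left_of rplane y y' -> (rpos y < rpos y')%R
}.

Definition on_segment (R : realType) (p q z : R * R) : Prop :=
  exists t : R, [/\ (0 <= t <= 1)%R,
    z.1 = ((1 - t) * p.1 + t * q.1)%R & z.2 = ((1 - t) * p.2 + t * q.2)%R].

Section Layout.
Variables (R : realType) (n : nat) (T : tanglegram n) (D : layout R T).

Definition on_edge (x : ltree (drawn D)) (y : rtree (drawn D)) : R * R -> Prop :=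
  on_segment (0%R, lpos x) (1%R, rpos y).

(* Distinct matching edges have distinct endpoints on either line, so they
   cross as soon as they share a point. *)
Definition crossing : Prop :=
  exists x y x' y',
    [/\ tmatch (drawn D) x y, tmatch (drawn D) x' y', (x, y) <> (x', y')
      & exists z, on_edge x y z /\ on_edge x' y' z].

End Layout.

Definition planar (R : realType) (n : nat) (T : tanglegram n) : Prop :=
  exists D : layout R T, ~ crossing D.

(** * Caterpillars and catergrams *)

(* A vertex of the caterpillar with [n.+2] leaves is either [inl i], the
   internal vertex at distance [i] from the root, or [inr j], the leaf whose
   distance label is [j.+1]: labels 1, ..., n.+2 are shifted down by one.
   The two deepest leaves are labelled n.+1 and n.+2; exchanging them is an
   automorphism of the caterpillar, so the choice is immaterial. *)
Definition cat_vertex (n : nat) : finType := ('I_n.+1 + 'I_n.+2)%type.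

Definition cat_adj (n : nat) (u v : cat_vertex n) : bool :=
  match u, v with
  | inl i, inl i' => (i' == i.+1 :> nat) || (i == i'.+1 :> nat)
  | inl i, inr j | inr j, inl i => i == minn j n :> nat
  | inr _, inr _ => false
  end.

Definition cat_root (n : nat) : cat_vertex n := inl ord0.

Definition cat_depth (n : nat) (u : cat_vertex n) : nat :=
  match u with inl i => i | inr j => (minn j n).+1 end.

Section Caterpillar.
Variable n : nat.
Implicit Types u v w : cat_vertex n.

Lemma cat_adj_sym : symmetric (@cat_adj n).
Proof. by move=> [i|j] [i'|j'] //=; rewrite orbC. Qed.

Lemma cat_adj_irr : irreflexive (@cat_adj n).
Proof. by move=> [i|j] //=; lia. Qed.

Lemma cat_adj_depth u v : cat_adj u v ->
  cat_depth v = (cat_depth u).+1 \/ cat_depth u = (cat_depth v).+1.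
Proof. by case: u v => [i|j] [i'|j'] //=; lia. Qed.

Definition cat_parent u : cat_vertex n :=
  match u with inl i => inl (inord i.-1) | inr j => inl (inord (minn j n)) end.

Lemma cat_parent_adj u : u != cat_root n ->
  cat_adj (cat_parent u) u /\ cat_depth u = (cat_depth (cat_parent u)).+1.
Proof.
case: u => [i|j] /=; last by rewrite inordK; lia.
move=> /eqP ui; have i0 : i <> 0 :> nat.
  by move=> i0; apply: ui; congr inl; apply/val_inj.
by rewrite inordK; have := ltn_ord i; lia.
Qed.

Lemma cat_lower_uniq u v : cat_adj u v -> cat_depth v <= cat_depth u ->
  v = cat_parent u.
Proof.
case: u v => [i|j] [i'|j'] //=; do ?[by lia] => a b; congr inl; apply/val_inj;
  rewrite /= inordK; have := ltn_ord i'; lia.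
Qed.

Lemma cat_walk_root u : walk (@cat_adj n) (cat_root n) u (cat_depth u).
Proof.
move: {-1}(cat_depth u) (erefl (cat_depth u)) => k; elim: k u => [|k IH] u uk.
  apply/existsP; exists [tuple] => /=; apply/eqP; apply/esym/eqP.
  by apply: contraT => /cat_parent_adj; lia.
have ur : u != cat_root n by apply/eqP => ur; move: uk; rewrite ur.
have [au du] := cat_parent_adj ur.
have /existsP[p /andP[pp /eqP lp]] : walk (@cat_adj n) (cat_root n) (cat_parent u) k.
  by apply: IH; lia.
apply/existsP; exists (rcons_tuple p u).
by rewrite rcons_path last_rcons pp lp au eqxx.
Qed.

Lemma cat_connected u v : connect (@cat_adj n) u v.
Proof.
have H w : connect (@cat_adj n) (cat_root n) w.
  have /existsP[p /andP[pp /eqP lp]] := cat_walk_root w.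
  by apply/connectP; exists p.
apply: connect_trans (H v).
by rewrite (sym_connect_sym cat_adj_sym).
Qed.

Lemma cat_acyclic (c : seq (cat_vertex n)) : ucycle (@cat_adj n) c -> size c <= 2.
Proof.
case: c => [//|x0 c0] ucc.
set c := x0 :: c0 in ucc *.
have x0c : x0 \in c by rewrite inE eqxx.
case: (@arg_maxnP _ x0 (mem c) (@cat_depth n) x0c) => x xc xmax.
case/rot_to: xc => k p Ek.
case/andP: ucc => cc uc.
have : path.cycle (@cat_adj n) (x :: p) by rewrite -Ek rot_cycle.
have : uniq (x :: p) by rewrite -Ek rot_uniq.
have sc : size c = (size p).+1 by rewrite -(size_rot k) Ek.
have pm w : w \in p -> cat_depth w <= cat_depth x.
  move=> wp; have wc : w \in c by rewrite -(mem_rot k) Ek inE wp orbT.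
  exact: xmax wc.
rewrite sc; case: p {Ek sc} pm => [//|y q] pm /= /and3P[_ yq _].
case/andP => xy; rewrite rcons_path => /andP[_ lx].
have yE : y = cat_parent x by apply: cat_lower_uniq => //; apply: pm; rewrite inE eqxx.
have lE : last y q = cat_parent x.
  apply: cat_lower_uniq; first by rewrite cat_adj_sym.
  by apply: pm; apply: mem_last.
case/lastP: q yq lE {pm lx} => [//|q z]; rewrite last_rcons mem_rcons inE => + zE.
by rewrite zE yE eqxx.
Qed.

Definition cat_rooted : rooted_tree :=
  @RootedTree (cat_vertex n) (@cat_adj n) (cat_root n)
    cat_adj_sym cat_adj_irr cat_connected cat_acyclic.

Lemma cat_dist (u : cat_rooted) : dist root u = cat_depth (u : cat_vertex n).
Proof.
rewrite /dist; case: ex_minnP => k wk kmin.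
apply/eqP; rewrite eqn_leq kmin ?cat_walk_root //=.
case/existsP: wk => p /andP[pp /eqP <-].
rewrite -[leqRHS](size_tuple p) -[leqRHS]addn0.
have -> : 0 = cat_depth (root : cat_rooted) by [].
elim: (tval p) (root : cat_rooted) pp => [|y q IH] x; first by rewrite /= add0n.
case/andP => /cat_adj_depth xy /IH /leq_trans; apply; rewrite [size (y :: q)]/=.
by rewrite addSnnS leq_add2l; case: xy => ->; rewrite ?leqnn // leqW ?leqnSn.
Qed.

Lemma cat_childE (v w : cat_rooted) :
  child v w = match v : cat_vertex n, w : cat_vertex n with
    | inl i, inl i' => i' == i.+1 :> nat
    | inl i, inr j => i == minn j n :> nat
    | inr _, _ => false
    end.
Proof.
rewrite /child !cat_dist; case: v w => [i|j] [i'|j'] //=; lia.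
Qed.

Definition cat_first (i : 'I_n.+1) : cat_vertex n := inr (inord i).

Definition cat_second (i : 'I_n.+1) : cat_vertex n :=
  if i < n then inl (inord i.+1) else inr ord_max.

Lemma cat_children_inl (i : 'I_n.+1) :
  @children cat_rooted (inl i) = [set cat_first i; cat_second i].
Proof.
apply/setP => w; rewrite inE cat_childE !inE /cat_first /cat_second.
have li := ltn_ord i; case: w => [i'|j].
  have li' := ltn_ord i'; case: ifP => h /=; rewrite /eq_op /= -?val_eqE /= ?inordK; lia.
have lj := ltn_ord j.
case: ifP => h /=; rewrite /eq_op /= -?val_eqE /= ?inordK; lia.
Qed.

Lemma cat_first_second (i : 'I_n.+1) : cat_first i != cat_second i.
Proof.
rewrite /cat_first /cat_second; case: ifP => h //.
by rewrite /eq_op /= -val_eqE /= inordK; have := ltn_ord i; lia.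
Qed.

Lemma cat_children_inr (j : 'I_n.+2) : @children cat_rooted (inr j) = set0.
Proof. by apply/setP => w; rewrite !inE cat_childE. Qed.

Lemma cat_leafE (u : cat_rooted) :
  leaf u = if (u : cat_vertex n) is inr _ then true else false.
Proof.
rewrite /leaf; case: u => [i|j]; last by rewrite cat_children_inr eqxx.
by rewrite cat_children_inl -cards_eq0 cards2 cat_first_second.
Qed.

Lemma cat_binary : is_binary cat_rooted.
Proof.
case=> [i|j]; [right | left]; last by rewrite cat_children_inr cards0.
by rewrite cat_children_inl cards2 cat_first_second.
Qed.

Definition caterpillar : rbtree := RBTree cat_binary.

Lemma caterpillar_size : #|[set u : caterpillar | leaf u]| = n.+2.
Proof.
rewrite -[RHS](card_ord n.+2) -cardsT.
rewrite -(card_imset _ (@inr_inj 'I_n.+1 'I_n.+2)); apply: eq_card => u.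
rewrite inE cat_leafE; apply/esym; case: u => [i|j].
  by apply/imsetP => -[].
by apply/imsetP; exists j.
Qed.

Definition cat_match (pi : 'S_n.+2) (u v : caterpillar) : bool :=
  match u : cat_vertex n, v : cat_vertex n with
  | inr j, inr k => pi j == k
  | _, _ => false
  end.

Variable pi : 'S_n.+2.

Lemma cat_match_leaf u v : cat_match pi u v -> leaf (u : caterpillar) && leaf (v : caterpillar).
Proof. by rewrite !cat_leafE; case: u v => [i|j] [i'|j']. Qed.

Lemma cat_match_l (u : caterpillar) : leaf u -> exists! v, cat_match pi u v.
Proof.
rewrite cat_leafE; case: u => [//|j] _; exists (inr (pi j)); split => /=.
  by rewrite /cat_match eqxx.
by case=> [//|k] /eqP ->.
Qed.

Lemma cat_match_r (v : caterpillar) : leaf v -> exists! u, cat_match pi u v.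
Proof.
rewrite cat_leafE; case: v => [//|k] _; exists (inr ((pi^-1)%g k)); split => /=.
  by rewrite /cat_match permKV eqxx.
by case=> [//|j] /eqP <-; rewrite permK.
Qed.

Definition catergram : tanglegram n.+2 :=
  Tanglegram caterpillar_size caterpillar_size cat_match_leaf cat_match_l cat_match_r.

End Caterpillar.

(** * The permutations *)

Definition rho_val (i j : nat) : nat :=
  if j == 1 then 2 else
  if j == 2 then 3 else
  if j == 3 then 5 else
  if j == 4 then 1 else
  if j <= 8 + 2 * i then (if odd j then j + 2 else j - 2) else
  if j == 9 + 2 * i then 10 + 2 * i else
  if j == 10 + 2 * i then 11 + 2 * i else
  if j == 11 + 2 * i then 12 + 2 * i else
  8 + 2 * i.

Lemma rho_val_bounds (i j : nat) :
  0 < j <= 12 + 2 * i -> 0 < rho_val i j <= 12 + 2 * i.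
Proof. by rewrite /rho_val; do !case: ifP => ?; lia. Qed.

Lemma rho_val_inj (i j k : nat) :
  0 < j <= 12 + 2 * i -> 0 < k <= 12 + 2 * i ->
  rho_val i j = rho_val i k -> j = k.
Proof. by rewrite /rho_val; do !case: ifP => ?; lia. Qed.

Lemma rho_ord_subproof (i : nat) (k : 'I_(12 + 2 * i)) :
  (rho_val i k.+1).-1 < 12 + 2 * i.
Proof.
have /andP[b0 b1] := @rho_val_bounds i k.+1 (ltn_ord k).
by rewrite prednK.
Qed.

Definition rho_ord (i : nat) (k : 'I_(12 + 2 * i)) : 'I_(12 + 2 * i) :=
  Ordinal (rho_ord_subproof k).

Lemma rho_ord_inj (i : nat) : injective (@rho_ord i).
Proof.
move=> j k /(congr1 val) /= jk; apply/val_inj/succn_inj.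
have /andP[bj _] := @rho_val_bounds i j.+1 (ltn_ord j).
have /andP[bk _] := @rho_val_bounds i k.+1 (ltn_ord k).
apply: (@rho_val_inj i); rewrite ?ltn_ord //.
by rewrite -(prednK bj) -(prednK bk) jk.
Qed.

Definition rho (i : nat) : 'S_(12 + 2 * i) := perm (@rho_ord_inj i).

(* The ordinal [k] stands for the element [k.+1] of {1, ..., 12 + 2 i}. *)
Lemma rhoE (i : nat) (k : 'I_(12 + 2 * i)) : (rho i k).+1 = rho_val i k.+1.
Proof.
have /andP[bk _] := @rho_val_bounds i k.+1 (ltn_ord k).
by rewrite permE /= prednK.
Qed.

(* Main.v *)
Require Import Defs.
From mathcomp Require Import all_boot all_order all_algebra all_fingroup reals.
From mathcomp Require Import zify lra.

(** In a plane caterpillar each internal vertex puts its leaf on one of two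
    sides of the remaining, deeper leaves.  Hence the leaves on the lower side
    appear in increasing order of label, and above them those on the upper side
    in decreasing order; any choice of sides can be realized.

    Suppose that [pi] is increasing on each of two classes that partition the
    labels (equivalently, [pi] avoids the pattern 321).  Send one class to the
    lower side of the left tree and the other class to its upper side, and put
    each leaf of the right tree on the side of its partner.  Both trees then
    list the first class increasingly and after it the second one decreasingly,
    and since [pi] is increasing on each class, matched leaves occur in the same
    order on the two lines.  Segments whose endpoints are ordered in the same
    way do not meet, so the catergram is planar ([planar_catergram]).

    The permutation [rho i] is such a union of two increasing sequences:
    1, 2, 3, 5, 7, ..., 9 + 2i, 10 + 2i, 11 + 2i is sent to
    2, 3, 5, 7, 9, ..., 10 + 2i, 11 + 2i, 12 + 2i, while
    4, 6, ..., 8 + 2i, 12 + 2i is sent to 1, 4, ..., 6 + 2i, 8 + 2i. *)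

Set Implicit Arguments.
Unset Strict Implicit.
Unset Printing Implicit Defensive.

Import Order.TTheory GRing.Theory Num.Theory.

Section PlaneCaterpillar.
Variables (n : nat) (upper : pred 'I_n.+2).

Definition cat_lchild (v : caterpillar n) : caterpillar n :=
  match v : cat_vertex n with
  | inl i => if upper (inord i) then cat_second i else cat_first i
  | inr _ => v
  end.

Definition cat_rchild (v : caterpillar n) : caterpillar n :=
  match v : cat_vertex n with
  | inl i => if upper (inord i) then cat_first i else cat_second i
  | inr _ => v
  end.

Lemma cat_plane_children (v : caterpillar n) :
  ~~ leaf v -> children v = [set cat_lchild v; cat_rchild v].
Proof.
rewrite cat_leafE; case: v => [i|j] // _.
rewrite /= (cat_children_inl i); case: ifP => // _.
exact: setUC.
Qed.

Definition cat_plane : plane (caterpillar n) := Plane cat_plane_children.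

(** Only the order of these values matters.  Since their absolute values
    decrease with the label, every leaf lies outside the range spanned by the
    deeper ones, on the side prescribed by [upper]. *)
Definition cat_height (j : 'I_n.+2) : int :=
  if upper j then (n.+2%:Z - j%:Z)%R else (j%:Z - n.+2%:Z)%R.

Definition cat_index (u : cat_vertex n) : nat :=
  match u with inl i => i | inr j => j end.

Lemma connect_cat_first (i : 'I_n.+1) (x : caterpillar n) :
  connect (@child (caterpillar n)) (cat_first i) x -> x = cat_first i.
Proof.
case/connectP => -[|y p] //=.
by rewrite cat_childE.
Qed.

Lemma connect_cat_second (i : 'I_n.+1) (x : caterpillar n) :
  connect (@child (caterpillar n)) (cat_second i) x -> i < cat_index x.
Proof.
have le_child (u v : caterpillar n) : child u v -> cat_index u <= cat_index v.
  by rewrite cat_childE; case: u v => [a|a] [b|b] //=; lia.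
have i_second : i < cat_index (cat_second i).
  by rewrite /cat_second; case: ifP => h /=; rewrite ?inordK //; lia.
case/connectP => p pp ->.
elim: p (cat_second i : caterpillar n) i_second pp => //= v p IHp u iu.
by case/andP => /le_child uv; apply: IHp; apply: leq_trans uv.
Qed.

Lemma cat_height_lower (j k : 'I_n.+2) :
  ~~ upper j -> j < k -> (cat_height j < cat_height k)%R.
Proof.
move=> /negbTE uj jk; rewrite /cat_height uj.
by have := ltn_ord k; case: ifP => _; lia.
Qed.

Lemma cat_height_upper (j k : 'I_n.+2) :
  upper j -> j < k -> (cat_height k < cat_height j)%R.
Proof.
move=> uj jk; rewrite /cat_height uj.
by have := ltn_ord k; case: ifP => _; lia.
Qed.

(** On internal vertices the value is arbitrary: only leaves are placed. *)
Definition cat_pos (R : realType) (u : caterpillar n) : R :=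
  match u : cat_vertex n with
  | inl _ => 0%R
  | inr j => ((cat_height j)%:~R)%R
  end.

Lemma cat_pos_mono (R : realType) (x y : caterpillar n) :
  leaf x -> leaf y -> left_of cat_plane x y -> (cat_pos R x < cat_pos R y)%R.
Proof.
rewrite !cat_leafE; case: x y => [//|j] [//|k] _ _ [v []].
rewrite cat_leafE; case: v => [i|//] _ /=.
have ltiE (m : 'I_n.+2) : i < m -> (inord i : 'I_n.+2) < m.
  by rewrite inordK // ltnS ltnW.
case: ifP => ui.
  move=> /connect_cat_second /ltiE ij /connect_cat_first [->].
  by rewrite ltr_int cat_height_upper.
move=> /connect_cat_first [->] /connect_cat_second /ltiE ik.
by rewrite ltr_int cat_height_lower ?ui.
Qed.

End PlaneCaterpillar.

(** At the common abscissa [t] the second segment is strictly higher, because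
    the gap between them is a convex combination of two positive numbers. *)
Lemma on_segment_disjoint (R : realType) (a b a' b' : R) (z : R * R) :
  (a < a')%R -> (b < b')%R ->
  on_segment (0%R, a) (1%R, b) z -> on_segment (0%R, a') (1%R, b') z -> False.
Proof.
move=> aa bb [t [/andP[t0 t1] /= zt ht]] [t' [_ /= zt' ht']].
have tt : t' = t by move: zt zt'; lra.
rewrite {t' zt'}tt in ht'.
have gap_a : (0 <= (1 - t) * (a' - a))%R by apply: mulr_ge0; lra.
move: t0; rewrite le_eqVlt => /orP[/eqP t0|t0].
  by move: ht ht'; rewrite -t0; lra.
have gap_b : (0 < t * (b' - b))%R by apply: mulr_gt0; lra.
by lra.
Qed.

Section TwoIncreasing.
Variables (n : nat) (pi : 'S_n.+2) (upper : pred 'I_n.+2).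
Hypothesis pi_increasing :
  forall j k, upper j = upper k -> j < k -> pi j < pi k.

Local Notation partner_upper := (fun k => upper ((pi^-1)%g k)).

(** Partners share a side, so leaves on different sides are ordered alike on
    both lines; on a common side the order is that of the labels, or its
    reverse, and [pi] preserves the order of the labels there. *)
Lemma cat_height_partner (j k : 'I_n.+2) :
  (cat_height upper j < cat_height upper k)%R ->
  (cat_height partner_upper (pi j) < cat_height partner_upper (pi k))%R.
Proof.
rewrite /cat_height !permK.
have := ltn_ord j; have := ltn_ord k.
have := ltn_ord (pi j); have := ltn_ord (pi k).
case uj: (upper j); case uk: (upper k); try lia.
  have := @pi_increasing k j; rewrite uj uk => /(_ erefl) + _ _ _ _; lia.
have := @pi_increasing j k; rewrite uj uk => /(_ erefl) + _ _ _ _; lia.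
Qed.

Lemma cat_height_inj : injective (cat_height upper).
Proof.
move=> j k; rewrite /cat_height => jk; apply/ord_inj; move: jk.
by have := ltn_ord j; have := ltn_ord k; case: ifP => _; case: ifP => _; lia.
Qed.

Lemma catergram_self_iso : tangle_iso (catergram pi) (catergram pi).
Proof. by exists id, id; split=> //; split=> //; exists id. Qed.

Definition two_sided_layout (R : realType) : layout R (catergram pi) :=
  Layout catergram_self_iso
    (@cat_pos_mono n upper R) (@cat_pos_mono n partner_upper R).

Lemma planar_catergram (R : realType) : planar R (catergram pi).
Proof.
exists (two_sided_layout R) => -[x [y [x' [y' [/= xy xy' ne [z []]]]]]].
rewrite /on_edge /=.
case: x y xy ne => [//|j] [//|_] /eqP <-.
case: x' y' xy' => [//|k] [//|_] /eqP <- ne zj zk.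
have lt_pos (a b : 'I_n.+2) :
    (cat_height upper a < cat_height upper b)%R ->
    (cat_pos upper R (inr a) < cat_pos upper R (inr b))%R /\
    (cat_pos partner_upper R (inr (pi a)) <
     cat_pos partner_upper R (inr (pi b)))%R.
  by move=> ab; rewrite !ltr_int cat_height_partner.
case: (ltgtP (cat_height upper j) (cat_height upper k)) => [jk|kj|].
- by have [l r] := lt_pos _ _ jk; apply: on_segment_disjoint l r zj zk.
- by have [l r] := lt_pos _ _ kj; apply: on_segment_disjoint l r zk zj.
- by move/cat_height_inj => jk; apply: ne; rewrite jk.
Qed.

End TwoIncreasing.

(** The class 4, 6, ..., 8 + 2i, 12 + 2i.  Of the even labels, 2 and 10 + 2i
    go with the odd ones, where [rho i] shifts labels upwards. *)
Definition rho_upper (i j : nat) : bool :=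
  ~~ odd j && (j != 2) && (j != 10 + 2 * i).

Lemma rho_val_increasing (i j k : nat) :
  0 < j -> k <= 12 + 2 * i -> rho_upper i j = rho_upper i k ->
  j < k -> rho_val i j < rho_val i k.
Proof.
by rewrite /rho_upper /rho_val; do !case: ifP => ?; lia.
Qed.

Theorem proposition20 (R : realType) (i : nat) (hi : 0 < i) :
  planar R (catergram (rho i)).
Proof.
apply: (@planar_catergram _ _ (fun j => rho_upper i j.+1)) => j k ujk jk.
by rewrite -ltnS !rhoE rho_val_increasing // ltn_ord.
Qed.
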